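(* $p=\sqrt{\log n/n}$ is a sharp threshold function for the property $rvd(G(n,p))=n$.
   Context: $G(n,p)$ is the random graph on $n$ vertices in which each edge is present independently with probability $p$. For a graph property $A$ and a function $p=p(n)$, $G(n,p)$ satisfies $A$ almost surely if the probability that $G(n,p(n))$ satisfies $A$ tends to $1$ as $n\to\infty$. In this paper, a function $f(n)$ is called a sharp threshold function for the property $A$ if there are two positive constants $c$ and $C$ such that $G(n,cf(n))$ almost surely does not satisfy $A$ and $G(n,p)$ satisfies $A$ almost surely for all $p\geq Cf(n)$. The property $rvd(G)=n$ means that $G$ is connected and its rainbow vertex-disconnection number equals its order $n$. All graphs are simple, finite and undirected. Let $G$ be a connected graph with at least two vertices whose vertices are colored (adjacent vertices may receive the same color). A set $X\subseteq V(G)$ is rainbow if no two vertices of $X$ have the same color. For two distinct vertices $x,y$ of $G$: if $x,y$ are nonadjacent, an $x$-$y$ rainbow vertex-cut is a rainbow set $S\subseteq V(G)\setminus\{x,y\}$ such that $x$ and $y$ belong to different components of $G-S$; if $x,y$ are adjacent, an $x$-$y$ rainbow vertex-cut is a set $S\subseteq V(G)\setminus\{x,y\}$ such that $x$ and $y$ belong to different components of $(G-xy)-S$ and at least one of $S\cup\{x\}$, $S\cup\{y\}$ is rainbow. The coloring is a rainbow vertex-disconnection coloring if every two distinct vertices $x,y$ of $G$ have an $x$-$y$ rainbow vertex-cut. The rainbow vertex-disconnection number $rvd(G)$ is the minimum number of colors in a rainbow vertex-disconnection coloring of $G$. *)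

(* Defs.v *)
From HB Require Import structures.
From mathcomp Require Import all_boot all_order all_algebra.
From mathcomp Require Import all_classical all_reals all_analysis.

Set Implicit Arguments.
Unset Strict Implicit.
Unset Printing Implicit Defensive.

Import Order.TTheory GRing.Theory Num.Theory.
Import numFieldNormedType.Exports.

Local Open Scope classical_set_scope.
Local Open Scope ring_scope.

Record sgraph (T : finType) := SGraph {
  edges : {set {set T}};
  edges_card2 : [forall e in edges, #|e| == 2%N] }.

HB.instance Definition _ (T : finType) := [isSub for @edges T].
HB.instance Definition _ (T : finType) := [Finite of sgraph T by <:].

Section RainbowVertexDisconnection.
Context {T : finType}.
Implicit Types (G : sgraph T) (S : {set T}) (x y : T).

Definition adj G : rel T := fun x y => [set x; y]%SET \in edges G.

Definition connected_graph G : bool := [forall x, forall y, connect (adj G) x y].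

(* Adjacency in G - xy. *)
Definition adj_del G x y : rel T :=
  fun u v => adj G u v && ([set u; v]%SET != [set x; y]%SET).

(* For x, y outside S: x and y lie in different components of e - S. *)
Definition separates (e : rel T) S x y : bool :=
  ~~ connect [rel u v | [&& u \notin S, v \notin S & e u v]] x y.

Definition rainbow (C : finType) (c : {ffun T -> C}) S : bool := dinjectiveb c S.

Definition rainbow_vertex_cut (C : finType) G (c : {ffun T -> C}) x y S : bool :=
  [&& x \notin S, y \notin S &
      if adj G x y
      then separates (adj_del G x y) S x y
           && (rainbow c (x |: S)%SET || rainbow c (y |: S)%SET)
      else separates (adj G) S x y && rainbow c S].

Definition rvd_coloring (C : finType) G (c : {ffun T -> C}) : bool :=
  [forall x, forall y, (x != y) ==> [exists S, rainbow_vertex_cut G c x y S]].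

Definition rvd_colorable G (k : nat) : bool :=
  [exists c : {ffun T -> 'I_k}, rvd_coloring G c].

(* Giving all vertices distinct colors works: take S to be everything but
   x and y. *)
Lemma rvd_colorable_exists G : exists k, rvd_colorable G k.
Proof.
exists #|T|; apply/existsP; exists [ffun x => enum_rank x].
apply/forallP => x; apply/forallP => y; apply/implyP => xy.
have rb S : rainbow [ffun x : T => enum_rank x] S.
  by apply/dinjectiveP => u v _ _; rewrite !ffunE => /enum_rank_inj.
have sep (e : rel T) : (forall v, e x v -> v != y) ->
    separates e (~: [set x; y])%SET x y.
  move=> exy; apply/negP => /connectP[[|v p] /=].
    by move=> _ yx; rewrite yx eqxx in xy.
  move=> /andP[/and3P[_ vS exv] vp] ylast.
  have vx : v = x.
    move: vS; rewrite !inE negbK => /orP[/eqP//|vy].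
    by rewrite (negPf (exy _ exv)) in vy.
  elim: p v vx vp ylast {vS exv} => [|w p IH] v -> /=.
    by move=> _ yx; rewrite yx eqxx in xy.
  move=> /andP[/and3P[_ wS xw] wp] yw; apply: (IH w) => //.
  move: wS; rewrite !inE negbK => /orP[/eqP//|wy].
  by rewrite (negPf (exy _ xw)) in wy.
apply/existsP; exists (~: [set x; y])%SET.
apply/and3P; split; rewrite ?inE ?eqxx ?orbT //.
case: ifP => Gxy; rewrite !rb ?andbT; apply: sep => v.
  by move=> /andP[_]; apply: contraNN => /eqP->.
by apply: contraTN => /eqP->; rewrite Gxy.
Qed.

Definition rvd G : nat := ex_minn (rvd_colorable_exists G).

End RainbowVertexDisconnection.

Section RandomGraph.
Context {R : realType}.

(* The probability that G(n,p) satisfies A; it is meant for 0 <= p <= 1. *)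
Definition Gnp_prob (n : nat) (p : R) (A : pred (sgraph 'I_n)) : R :=
  \sum_(G : sgraph 'I_n | A G)
    \prod_(e : {set 'I_n} | #|e| == 2%N) (if e \in edges G then p else 1 - p).

Definition almost_surely (p : nat -> R) (A : forall n, pred (sgraph 'I_n)) : Prop :=
  (fun n => Gnp_prob (p n) (A n)) @ \oo --> (1 : R).

(* The lower bound on p is only required for large n: for small n, C * f n
   may exceed 1, and then no edge probability satisfies it. *)
Definition sharp_threshold (f : nat -> R) (A : forall n, pred (sgraph 'I_n)) : Prop :=
  exists c C : R,
    [/\ 0 < c, 0 < C,
        almost_surely (fun n => c * f n) (fun n G => ~~ A n G) &
        forall p : nat -> R,
          (forall n, 0 <= p n <= 1) ->
          (\forall n \near \oo, C * f n <= p n) ->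
          almost_surely p A].

End RandomGraph.

(* Main.v *)
Require Import Defs.
From mathcomp Require Import all_boot all_order all_algebra.
From mathcomp Require Import all_classical all_reals all_analysis.
From mathcomp Require Import zify ring lra.

Set Implicit Arguments.
Unset Strict Implicit.
Unset Printing Implicit Defensive.

Import Order.TTheory GRing.Theory Num.Theory.
Import numFieldNormedType.Exports.
Local Open Scope ring_scope.

(** The property [rvd G = n] is a statement about common neighbours: it holds
    exactly when any two vertices have at least two of them. Indeed, if [u] and
    [v] are both adjacent to [x] and to [y], then every cut between [x] and [y]
    contains [u] and [v], so [u] and [v] have different colours
    ([rvd_two_common_nbrs]). If [u] and [v] have at most one common neighbour,
    they may share a colour while all other vertices get colours of their own
    ([rvd_lt_card]). Two common neighbours for every pair also make the graph
    connected.

    Above the threshold, with constant 3, a union bound suffices. A pair [u, v]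
    has two common neighbours as soon as, for every [w], it has one outside
    [{u, v, w}]. For fixed [u, v, w] this fails with probability at most
    [(1 - p ^ 2) ^ (n - 3) <= exp (- p ^ 2 * (n - 3)) <= n ^ -4] for large [n],
    and there are at most [n ^ 3] triples ([Gnp_rvd_maximal_ge],
    [triple_failure_le]).

    Below the threshold, with constant 1/4, no second moment computation is
    needed: a single vertex [u] is fixed and its neighbourhood [A] is revealed.
    An exponential Markov inequality gives [#|A| < 4 * n * p] outside an event
    of probability at most [exp (- n * p)] ([degree_tail]). The edges between
    [A] and the vertices outside [A] and [u] have not been revealed, so each
    such vertex [v] independently misses [A] with probability
    [(1 - p) ^ #|A| >= exp (- 8 * n * p ^ 2) = n ^ (-1/2)]. There are at least
    [n / 2] candidates [v], hence some [v] has no common neighbour with [u] but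
    for an event of probability at most [exp (- sqrt n / 2)]
    ([Gnp_rvd_maximal_le], [Gnp_rvd_maximal_small]). *)

(** * Colourings and common neighbours *)

Section RainbowCuts.
Context {T : finType}.
Implicit Types (G : sgraph T) (S : {set T}) (x y : T).

Lemma adjC G x y : adj G x y = adj G y x.
Proof. by rewrite /adj finset.setUC. Qed.

Lemma adj_irr G x : adj G x x = false.
Proof.
apply/negP => xx; have /forallP/(_ [set x; x]%SET)/implyP/(_ xx) := edges_card2 G.
by rewrite finset.setUid cards1.
Qed.

Lemma separates_nbhd (e : rel T) S x y :
  x != y -> (forall v, e x v -> v \in S) -> separates e S x y.
Proof.
move=> xy exS; apply/negP => /connectP[[|v s] /=].
  by move=> _ yx; rewrite yx eqxx in xy.
by move=> /andP[/and3P[_ /negP vS /exS]].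
Qed.

Lemma separatesC (e : rel T) S x y :
  symmetric e -> separates e S x y = separates e S y x.
Proof.
move=> esym; rewrite /separates sym_connect_sym// => u v /=.
by rewrite esym andbCA.
Qed.

Lemma rainbow_cutC (C : finType) G (c : {ffun T -> C}) x y S :
  rainbow_vertex_cut G c x y S = rainbow_vertex_cut G c y x S.
Proof.
have delC : adj_del G x y = adj_del G y x.
  by rewrite /adj_del [in LHS]finset.setUC.
have delS : symmetric (adj_del G y x).
  by move=> u v; rewrite /adj_del adjC finset.setUC.
rewrite /rainbow_vertex_cut andbCA adjC delC (separatesC _ _ _ delS).
by rewrite [separates (adj G) _ _ _]separatesC 1?orbC//; apply: adjC.
Qed.

Lemma rainbow_subset (C : finType) (c : {ffun T -> C}) S S' :
  S \subset S' -> rainbow c S' -> rainbow c S.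
Proof.
move=> /fintype.subsetP sS /dinjectiveP inj; apply/dinjectiveP => u v /sS uS /sS vS.
exact: inj.
Qed.

(** Neither adjacency nor nonadjacency of [x] and [y] is assumed: the edge
    [xy] is either removed or absent, so it is enough that [S] contains the
    neighbours of [x] other than [y]. *)
Lemma rainbow_cut_nbhd (C : finType) G (c : {ffun T -> C}) x y S :
    x != y -> x \notin S -> y \notin S ->
    (forall v, adj G x v -> v != y -> v \in S) ->
    rainbow c (x |: S)%SET || rainbow c (y |: S)%SET ->
  rainbow_vertex_cut G c x y S.
Proof.
move=> xy xS yS nbS rb; rewrite /rainbow_vertex_cut xS yS /=.
case: ifPn => [Gxy|nGxy]; apply/andP; split => //.
- apply: separates_nbhd => // v /andP[Gxv xv]; apply: nbS => //.
  by apply: contraNneq xv => ->.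
- apply: separates_nbhd => // v Gxv; apply: nbS => //.
  by apply: contraNneq nGxy => <-.
- by case/orP: rb; apply: rainbow_subset; apply: finset.subsetUr.
Qed.

Lemma rainbow_comp (C D : finType) (c : {ffun T -> C}) (d : {ffun T -> D}) S :
  (forall x y, c x = c y -> d x = d y) -> rainbow d S -> rainbow c S.
Proof.
move=> cd /dinjectiveP inj; apply/dinjectiveP => u v uS vS /cd.
exact: inj.
Qed.

(** A colouring finer than a rainbow vertex-disconnection colouring is one. *)
Lemma rvd_coloring_comp (C D : finType) G (c : {ffun T -> C}) (d : {ffun T -> D}) :
    (forall x y, c x = c y -> d x = d y) ->
  rvd_coloring G d -> rvd_coloring G c.
Proof.
move=> cd /forallP Gd; apply/forallP => x; apply/forallP => y; apply/implyP => xy.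
have /existsP[S] := implyP (forallP (Gd x) y) xy.
move=> /and3P[xS yS cut]; apply/existsP; exists S; apply/and3P; split => //.
move: cut; case: ifP => _ /andP[-> /=].
  by move=> /orP[] /(rainbow_comp cd) ->; rewrite ?orbT.
exact: rainbow_comp.
Qed.

Lemma rvd_min G k : rvd_colorable G k -> (rvd G <= k)%N.
Proof. by rewrite /rvd; case: ex_minnP => m _; apply. Qed.

Lemma rvd_le_image (C : finType) G (c : {ffun T -> C}) :
  rvd_coloring G c -> (rvd G <= #|[set c x | x : T]|)%N.
Proof.
move=> Gc; apply: rvd_min; set D := [set c x | x : T]%SET.
have cD x : c x \in D by apply: imset_f.
apply/existsP; exists [ffun x => enum_rank_in (cD x) (c x)].
apply: rvd_coloring_comp Gc => x y; rewrite !ffunE => /(congr1 enum_val).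
by rewrite !enum_rankK_in.
Qed.

(** All vertices may receive distinct colours. *)
Lemma rvd_le_card G : (rvd G <= #|T|)%N.
Proof.
apply: leq_trans (rvd_le_image (c := [ffun x => x]) _) (max_card _).
apply/forallP => x; apply/forallP => y; apply/implyP => xy.
have rb S : rainbow [ffun x : T => x] S.
  by apply/dinjectiveP => u v _ _; rewrite !ffunE.
apply/existsP; exists (~: [set x; y])%SET.
apply: rainbow_cut_nbhd; rewrite ?rb ?inE ?eqxx ?orbT// => v Gxv vy.
by rewrite !inE negb_or vy andbT; apply: contraTneq Gxv => ->; rewrite adj_irr.
Qed.

(** [u] and [v] have at least two common neighbours. *)
Definition two_common_nbrs G u v : bool :=
  [exists x, exists y, [&& x != y, adj G u x, adj G v x, adj G u y & adj G v y]].

(** A common neighbour of [x] and [y] lies in every cut between them. *)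
Lemma mem_cut (C : finType) G (c : {ffun T -> C}) x y S u :
  rainbow_vertex_cut G c x y S -> adj G u x -> adj G u y -> u \in S.
Proof.
move=> /and3P[xS yS cut] ux uy; apply/negPn/negP => uS.
have ux' : u != x by apply: contraTneq ux => ->; rewrite adj_irr.
have uy' : u != y by apply: contraTneq uy => ->; rewrite adj_irr.
have two (e : rel T) : e x u -> e u y -> separates e S x y = false.
  move=> xu uy2; apply/negbF; apply: (@connect_trans _ _ u); apply: connect1 => /=.
    by rewrite xS uS.
  by rewrite yS uS.
move: cut; case: ifP => _; rewrite two //= /adj_del ?[adj G x u]adjC ?ux ?uy //=;
  apply/eqP => /setP/(_ u); rewrite !inE eqxx ?orbT ?(negPf ux') ?(negPf uy') //.
Qed.

Lemma rvd_two_common_nbrs G :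
  (forall u v, u != v -> two_common_nbrs G u v) -> rvd G = #|T|.
Proof.
move=> G2; apply/eqP; rewrite eqn_leq rvd_le_card /=.
rewrite /rvd; case: ex_minnP => k /existsP[c Gc] _.
rewrite -[leqRHS](card_ord k); apply: (leq_card c) => u v cuv; apply/eqP.
apply/negPn/negP => uv; have /existsP[x /existsP[y]] := G2 u v uv.
move=> /and5P[xy ux vx uy vy].
have /existsP[S cut] := implyP (forallP (forallP Gc x) y) xy.
have uS := mem_cut cut ux uy; have vS := mem_cut cut vx vy.
have /dinjectiveP inj : rainbow c S.
  case/and3P: cut => _ _; case: ifP => _ /andP[_] //.
  by case/orP; apply: rainbow_subset; apply: finset.subsetUr.
by move: uv; rewrite (inj _ _ uS vS cuv) eqxx.
Qed.

(** Colour [u] like [v] and the other vertices with distinct colours. A set is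
    then rainbow unless it contains both [u] and [v], and of any two other
    vertices one is not adjacent to both [u] and [v]: the one of [u, v] that it
    misses may be left out of the cut. *)
Lemma rvd_lt_card G u v :
  u != v -> ~~ two_common_nbrs G u v -> (rvd G < #|T|)%N.
Proof.
move=> uv G2; pose c := [ffun x => if x == u then v else x].
have rb S : ~~ ((u \in S) && (v \in S)) -> rainbow c S.
  move=> uvS; apply/dinjectiveP => x y xS yS; rewrite !ffunE.
  case: eqVneq => [xu|xu]; case: eqVneq => [yu|yu]; first by rewrite xu yu.
  - by move=> vy; rewrite vy -xu xS yS in uvS.
  - by move=> xv; rewrite -xv -yu xS yS in uvS.
  - by [].
suff /rvd_le_image/leq_ltn_trans : rvd_coloring G c.
  apply; apply: (@leq_ltn_trans #|[set~ u]|).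
    apply/subset_leq_card/fintype.subsetP => _ /imsetP[x _ ->].
    by rewrite !inE ffunE; case: (eqVneq x u) => [_|//]; rewrite eq_sym.
  by rewrite cardsC1 ltn_predL; apply/card_gt0P; exists u.
apply/forallP => x; apply/forallP => y; apply/implyP => xy.
(* If one of [x, y] is [u] or [v], it does not belong to the complement of
   [{x, y}] extended with the other one, which is therefore rainbow. *)
have [xyuv|] := boolP [|| x == u, x == v, y == u | y == v].
  apply/existsP; exists (~: [set x; y])%SET.
  apply: rainbow_cut_nbhd; rewrite ?inE ?eqxx ?orbT//.
    move=> w Gxw wy; rewrite !inE negb_or wy andbT.
    by apply: contraTneq Gxw => ->; rewrite adj_irr.
  suff /orP[h|h] : ~~ ((u \in x |: ~: [set x; y]) && (v \in x |: ~: [set x; y]))%SET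
     || ~~ ((u \in y |: ~: [set x; y]) && (v \in y |: ~: [set x; y]))%SET.
    1,2: by rewrite (rb _ h) ?orbT.
  rewrite !inE; case/or4P: xyuv => /eqP<-; rewrite !eqxx ?orbT /=.
  - by rewrite (negPf xy) orbT.
  - by rewrite (negPf xy) !andbF orbT.
  - by rewrite eq_sym (negPf xy).
  - by rewrite [y == x]eq_sym (negPf xy) !andbF.
rewrite !negb_or => /and4P[xu xv yu yv].
(* Otherwise a vertex [z] among [u, v] that is not adjacent to [a] may be
   left out of the cut between [a] and [b]. *)
have cutP a b z : a != b -> z \in [set u; v]%SET -> a != u -> a != v -> b != u -> b != v ->
    ~~ adj G a z -> rainbow_vertex_cut G c a b (~: [set a; b; z])%SET.
  move=> ab zuv au av bu bv az; apply: rainbow_cut_nbhd => //; rewrite ?inE ?eqxx ?orbT //.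
    move=> w Gaw wb; rewrite !inE !negb_or wb andbT /=.
    by apply/andP; split; apply: contraTneq Gaw => ->; rewrite ?adj_irr.
  apply/orP; left; apply: rb; move: zuv; rewrite !inE.
  rewrite ![u == _]eq_sym ![v == _]eq_sym (negPf au) (negPf av) (negPf bu) (negPf bv) /=.
  by case/orP => /eqP->; rewrite eqxx ?andbF.
have [xz|yz] : (exists2 z, z \in [set u; v]%SET & ~~ adj G x z) \/
               (exists2 z, z \in [set u; v]%SET & ~~ adj G y z).
- move: G2; rewrite negb_exists => /forallP/(_ x); rewrite negb_exists.
  move=> /forallP/(_ y); rewrite xy /= !negb_and.
  by case/or4P => h; [left; exists u|left; exists v|right; exists u|right; exists v];
    rewrite ?inE ?eqxx ?orbT // adjC.
- case: xz => z zuv xz; apply/existsP; eexists; exact: (cutP x y z).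
- case: yz => z zuv yz; apply/existsP; eexists; rewrite rainbow_cutC.
  by apply: (cutP y x z) => //; rewrite eq_sym.
Qed.

End RainbowCuts.

(** * Random subsets and independence *)

Section RandomSubset.
Context {R : numDomainType} {I : finType}.
Variable q : I -> R.
Implicit Types (E B : {set I}) (f g : {set I} -> R).

(** Weight of [E] as a random subset of [I] that contains each [i]
    independently with probability [q i]. *)
Definition subset_weight E : R := \prod_i (if i \in E then q i else 1 - q i).

(** Expectation of [f] at that random subset; the probability of an event is
    the expectation of its 0-1 indicator. *)
Definition subset_mean f : R := \sum_(E : {set I}) subset_weight E * f E.

Local Notation "''E' f" := (subset_mean f) (at level 10, f at level 8).

Lemma mean_eq f g : f =1 g -> 'E f = 'E g.
Proof. by move=> fg; apply: eq_bigr => E _; rewrite fg. Qed.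

Lemma mean_prod (a : I -> R) :
  'E (fun E => \prod_(i in E) a i) = \prod_i (q i * a i + (1 - q i)).
Proof.
rewrite bigA_distr; apply: eq_bigr => E _.
rewrite [X in _ * X]big_mkcond -big_split /=; apply: eq_bigr => i _.
by case: ifP; rewrite ?mulr1.
Qed.

Lemma mean1 : 'E (fun=> 1) = 1.
Proof.
transitivity ('E (fun E => \prod_(i in E) (1 : R))).
  by apply: mean_eq => E; rewrite big1.
rewrite (mean_prod (fun=> 1)) big1// => i _.
by rewrite mulr1 addrC subrK.
Qed.

Lemma meanZ a f : 'E (fun E => a * f E) = a * 'E f.
Proof. by rewrite /subset_mean mulr_sumr; apply: eq_bigr => E _; rewrite mulrCA. Qed.

Lemma meanD f g : 'E (fun E => f E + g E) = 'E f + 'E g.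
Proof.
by rewrite /subset_mean -big_split; apply: eq_bigr => E _; rewrite mulrDr.
Qed.

Lemma meanB1 f : 'E (fun E => 1 - f E) = 1 - 'E f.
Proof.
rewrite meanD mean1; congr (_ + _).
by rewrite -mulN1r -meanZ; apply: mean_eq => E; rewrite mulN1r.
Qed.

Lemma mean_sum (J : finType) (P : pred J) (f : J -> {set I} -> R) :
  'E (fun E => \sum_(j | P j) f j E) = \sum_(j | P j) 'E (f j).
Proof.
rewrite /subset_mean exchange_big; apply: eq_bigr => E _.
by rewrite mulr_sumr.
Qed.

Lemma mean_mem i : 'E (fun E => (i \in E)%:R) = q i.
Proof.
apply: (addIr (- 1)); rewrite -[LHS]opprB -[RHS]opprB; congr (- _).
rewrite -meanB1.
transitivity ('E (fun E => \prod_(j in E) (j != i)%:R)).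
  apply: mean_eq => E; have [iE|iE] := boolP (i \in E).
    by rewrite (bigD1 i) //= eqxx mul0r subrr.
  rewrite big1 ?subr0// => j jE; suff -> : j != i by [].
  by apply: contraNneq iE => <-.
rewrite (mean_prod (fun j => (j != i)%:R)) (bigD1 i) //= eqxx mulr0 add0r.
by rewrite big1 ?mulr1// => j ->; rewrite mulr1 addrC subrK.
Qed.

(** [f E] is determined by the elements of [E] that lie in [B]. *)
Definition depends_on B f := forall E E', E :&: B = E' :&: B -> f E = f E'.

Lemma depends_onS B B' f : B \subset B' -> depends_on B f -> depends_on B' f.
Proof.
move=> /finset.setIidPr BB' fB E E' EE'; apply: fB.
by rewrite -BB' !finset.setIA EE'.
Qed.

Lemma depends_on_mem B i : i \in B -> depends_on B (fun E => (i \in E)%:R).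
Proof.
move=> iB E E' /setP/(_ i).
by rewrite !inE iB !andbT => ->.
Qed.

Lemma depends_onM B f g :
  depends_on B f -> depends_on B g -> depends_on B (fun E => f E * g E).
Proof. by move=> fB gB E E' EE'; rewrite (fB _ _ EE') (gB _ _ EE'). Qed.

Lemma depends_on_prod B (J : finType) (P : pred J) (f : J -> {set I} -> R) :
    (forall j, P j -> depends_on B (f j)) ->
  depends_on B (fun E => \prod_(j | P j) f j E).
Proof. by move=> fB E E' EE'; apply: eq_bigr => j /fB; apply. Qed.

Lemma depends_on1B B f : depends_on B f -> depends_on B (fun E => 1 - f E).
Proof. by move=> fB E E' /fB ->. Qed.

(** Functions of disjoint sets of coordinates are independent. Two independent
    copies of the random subset may exchange their traces outside [B] without
    changing their joint weight; this turns the product of the two expectations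
    into the expectation of the product. *)
Lemma mean_indep B f g : depends_on B f -> depends_on (~: B) g ->
  'E (fun E => f E * g E) = 'E f * 'E g.
Proof.
move=> fB gB; pose mix E1 E2 := ((E1 :&: B) :|: (E2 :&: ~: B))%SET.
have mixB E1 E2 : mix E1 E2 :&: B = E1 :&: B.
  by apply/setP => i; rewrite !inE; case: (i \in B); rewrite ?andbT ?andbF ?orbF.
have mixCB E1 E2 : mix E1 E2 :&: ~: B = E2 :&: ~: B.
  by apply/setP => i; rewrite !inE; case: (i \in B); rewrite ?andbT ?andbF ?orbF.
pose swap (E : {set I} * {set I}) := (mix E.1 E.2, mix E.2 E.1).
have swapK : involutive swap.
  move=> [E1 E2]; congr (_, _); apply/setP => i; rewrite !inE /=;
  by case: (i \in B); rewrite ?andbT ?andbF ?orbF.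
pose w (E : {set I} * {set I}) := subset_weight E.1 * subset_weight E.2.
have wswap X : w (swap X) = w X.
  rewrite /w /subset_weight -!big_split; apply: eq_bigr => i _ /=.
  rewrite !inE; case: (i \in B); rewrite ?andbT ?andbF ?orbF//=.
  by rewrite mulrC.
transitivity (\sum_X w X * (f X.1 * g X.1)).
  rewrite -[LHS]mulr1 -mean1 /subset_mean big_distrlr pair_bigA /=.
  by apply: eq_bigr => -[E1 E2] _ /=; rewrite /w /=; ring.
rewrite (reindex_inj (inv_inj swapK)) /subset_mean big_distrlr pair_bigA /=.
apply: eq_bigr => -[E1 E2] _; rewrite wswap /w /=.
by rewrite (fB _ _ (mixB _ _)) (gB _ _ (mixCB _ _)); ring.
Qed.

Lemma mean_indep_prod (J : finType) (P : pred J) (B : J -> {set I})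
    (f : J -> {set I} -> R) :
    (forall j, P j -> depends_on (B j) (f j)) ->
    (forall j k, P j -> P k -> j != k -> [disjoint B j & B k]) ->
  'E (fun E => \prod_(j | P j) f j E) = \prod_(j | P j) 'E (f j).
Proof.
move=> fB disj.
suff H (s : seq J) : uniq s -> 'E (fun E => \prod_(j <- s | P j) f j E)
    = \prod_(j <- s | P j) 'E (f j) by apply/H/index_enum_uniq.
elim: s => [|j s IH] /=.
  move=> _; rewrite big_nil -[RHS]mean1.
  by apply: mean_eq => E; rewrite big_nil.
move=> /andP[js us]; rewrite big_cons -IH//.
case: ifP => Pj; last by apply: mean_eq => E; rewrite big_cons Pj.
rewrite -(@mean_indep (B j)) => [||E E' EE'].
- by apply: mean_eq => E; rewrite big_cons Pj.
- exact: fB.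
- rewrite big_seq_cond [RHS]big_seq_cond; apply: eq_bigr => k /andP[ks Pk].
  apply: (depends_onS _ (fB k Pk)) EE'; rewrite -finset.disjoints_subset.
  by apply: disj => //; apply: contraNneq js => <-.
Qed.

Hypothesis q01 : forall i, 0 <= q i <= 1.

Lemma subset_weight_ge0 E : 0 <= subset_weight E.
Proof.
apply: prodr_ge0 => i _; have /andP[q0 q1] := q01 i.
by case: ifP; rewrite ?subr_ge0.
Qed.

Lemma le_mean f g : (forall E, f E <= g E) -> 'E f <= 'E g.
Proof.
by move=> fg; apply: ler_sum => E _; rewrite ler_wpM2l ?subset_weight_ge0.
Qed.

End RandomSubset.

(** * The random graph *)

Lemma natrE_andb (R : pzSemiRingType) (a b : bool) : (a && b)%:R = a%:R * b%:R :> R.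
Proof. by rewrite -natrM mulnb. Qed.

Lemma expR_half_le2 (R : realType) : expR 2^-1 <= 2 :> R.
Proof.
rewrite -[leLHS]invrK -[leRHS]invrK lef_pV2 ?posrE ?invr_gt0 ?expR_gt0// -expRN.
by apply: le_trans (expR_ge1Dx _); lra.
Qed.

Section RandomGraph.
Context {R : realType} {n : nat}.
Variable p : R.
Implicit Types (u v w : 'I_n) (E : {set {set 'I_n}}).

(** The random graph as a random set of sets of vertices: sets other than pairs
    have probability 0. *)
Definition edge_prob (e : {set 'I_n}) : R := if #|e| == 2%N then p else 0.

Definition pairs : {set {set 'I_n}} := [set e : {set 'I_n} | #|e| == 2%N]%SET.

Fact graph_of_subproof E : [forall e in E :&: pairs, #|e| == 2%N].
Proof. by apply/forallP => e; apply/implyP; rewrite !inE => /andP[]. Qed.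

(** The graph with the pairs in [E] for edges; other members are ignored. *)
Definition graph_of E : sgraph 'I_n := SGraph (graph_of_subproof E).

Local Notation "''E' f" := (subset_mean edge_prob f) (at level 10, f at level 8).

Lemma adj_graph_of E u v : adj (graph_of E) u v = (u != v) && ([set u; v]%SET \in E).
Proof. by rewrite /adj !inE cards2 andbC; case: (u != v). Qed.

Lemma Gnp_probE (A : pred (sgraph 'I_n)) :
  Gnp_prob p A = 'E (fun E => (A (graph_of E))%:R).
Proof.
rewrite /subset_mean (bigID (fun E : {set {set 'I_n}} => E \subset pairs)) /=.
rewrite [X in _ + X]big1 ?addr0; last first.
  move=> E /fintype.subsetPn[e eE]; rewrite inE => e2.
  by rewrite /subset_weight (bigD1 e) //= eE /edge_prob (negPf e2) !mul0r.
rewrite (reindex_onto (fun G : sgraph 'I_n => edges G) graph_of) /=; last first.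
  by move=> E /finset.setIidPl.
rewrite /Gnp_prob big_mkcond /= [RHS]big_mkcond; apply: eq_bigr => G _.
have Gp : edges G \subset pairs.
  apply/fintype.subsetP => e eG; rewrite inE.
  by have /forallP/(_ e)/implyP/(_ eG) := edges_card2 G.
have -> : graph_of (edges G) = G by apply: val_inj; apply/finset.setIidPl.
rewrite Gp eqxx /=; case: ifP; rewrite ?mulr0// mulr1 => _.
rewrite /subset_weight big_mkcond; apply: eq_bigr => e _.
rewrite /edge_prob; case: ifPn => [//|e2].
rewrite subr0 ifF//; apply/negP => /(fintype.subsetP Gp).
by rewrite inE (negPf e2).
Qed.

Lemma Gnp_probC (A : pred (sgraph 'I_n)) :
  Gnp_prob p (fun G => ~~ A G) = 1 - Gnp_prob p A.
Proof.
rewrite !Gnp_probE -meanB1; apply: mean_eq => E.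
by case: (A _); rewrite ?subrr ?subr0.
Qed.

Lemma mean_edge u v : u != v -> 'E (fun E => ([set u; v] \in E)%:R) = p.
Proof. by move=> uv; rewrite mean_mem /edge_prob cards2 uv. Qed.

Lemma edge_inj u v x y :
  u != y -> [set u; v]%SET = [set x; y]%SET -> u = x /\ (u != v -> v = y).
Proof.
move=> uy /setP H; have := H u; rewrite !inE eqxx (negPf uy) orbF => /esym/eqP ux.
split=> // uv; have := H v; rewrite !inE eqxx orbT -ux [v == u]eq_sym (negPf uv) /=.
by move=> /esym/eqP.
Qed.

(** No vertex outside [{u, v, w}] is adjacent to both [u] and [v]. *)
Definition no_common_nbr u v w E : bool :=
  [forall x, (x \notin [set u; v; w]%SET) ==>
     ~~ (([set u; x]%SET \in E) && ([set v; x]%SET \in E))].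

Lemma mean_no_common_nbr u v w : u != v ->
  'E (fun E => (no_common_nbr u v w E)%:R) = (1 - p ^+ 2) ^+ #|~: [set u; v; w]%SET|.
Proof.
move=> uv.
pose f (x : 'I_n) (E : {set {set 'I_n}}) : R :=
  1 - ([set u; x]%SET \in E)%:R * ([set v; x]%SET \in E)%:R.
pose B x : {set {set 'I_n}} := [set [set u; x]; [set v; x]]%SET.
have dep x : depends_on (B x) (f x).
  apply: depends_on1B; apply: depends_onM.
    by apply: depends_on_mem; rewrite !inE eqxx.
  by apply: depends_on_mem; rewrite !inE eqxx orbT.
transitivity ('E (fun E => \prod_(x | x \notin [set u; v; w]%SET) f x E)).
  apply: mean_eq => E; rewrite /no_common_nbr.
  case: forallP => [H|H].
    rewrite big1// => x /(implyP (H x)); rewrite /f -natrE_andb => /negPf ->.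
    by rewrite subr0.
  move/existsNP: H => [x /negP]; rewrite negb_imply negbK => /andP[xuvw ex].
  by rewrite (bigD1 x)//= /f -natrE_andb ex subrr mul0r.
rewrite (mean_indep_prod _ (B := B)) //=; last first.
  move=> x y; rewrite !inE !negb_or => /andP[/andP[xu xv] _] /andP[/andP[yu yv] _] xy.
  have inj a b : a != x -> b != y -> a != y -> [set a; x]%SET != [set b; y]%SET.
    move=> ax bY ay; apply/eqP => /(edge_inj ay) [_ /(_ ax)].
    by move/eqP; rewrite (negPf xy).
  rewrite -finset.setI_eq0; apply/eqP/setP => e; rewrite !inE; apply/negP.
  move: xu xv yu yv; rewrite ![_ == u]eq_sym ![_ == v]eq_sym => xu xv yu yv.
  by move=> /andP[] /orP[] /eqP -> /orP[] h; move: h; rewrite (negPf (inj _ _ _ _ _)).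
rewrite -prodr_const; apply: eq_big => [x|x]; first by rewrite finset.in_setC.
rewrite !inE !negb_or => /andP[/andP[xu xv] _].
rewrite meanB1 (@mean_indep _ _ _ [set [set u; x]]%SET).
- by rewrite !mean_edge 1?eq_sym// expr2.
- by apply: depends_on_mem; rewrite inE.
- apply: depends_on_mem; rewrite !inE; apply: contraNneq uv => ux.
  have : v \in [set u; x]%SET by rewrite -ux !inE eqxx.
  by rewrite !inE => /orP[/eqP->//|/eqP vx]; rewrite vx eqxx in xv.
Qed.

Hypothesis p01 : 0 <= p <= 1.

Lemma edge_prob01 (e : {set 'I_n}) : 0 <= edge_prob e <= 1.
Proof. by rewrite /edge_prob; case: ifP => // _; rewrite lexx ler01. Qed.

Let le_E := le_mean edge_prob01.

Lemma rvd_maximal_of_common_nbrs E :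
    (forall u v w, u != v -> ~~ no_common_nbr u v w E) ->
  connected_graph (graph_of E) && (rvd (graph_of E) == n).
Proof.
move=> HE.
have nbr u v w : u != v -> exists x, [/\ x \notin [set u; v; w]%SET,
    adj (graph_of E) u x & adj (graph_of E) v x].
  move=> uv; have := HE u v w uv; rewrite negb_forall => /existsP[x].
  rewrite negb_imply negbK => /and3P[xuvw ux vx]; exists x; split => //.
    by rewrite adj_graph_of ux andbT; apply: contraNneq xuvw => <-; rewrite !inE eqxx.
  by rewrite adj_graph_of vx andbT; apply: contraNneq xuvw => <-; rewrite !inE eqxx orbT.
apply/andP; split.
  apply/forallP => u; apply/forallP => v; have [->|uv] := eqVneq u v.
    exact: connect0.
  have [x [_ ux vx]] := nbr u v u uv.
  by apply: (connect_trans (connect1 ux)); apply: connect1; rewrite adjC.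
rewrite -[X in _ == X](card_ord n); apply/eqP/rvd_two_common_nbrs => u v uv.
have [x [_ ux vx]] := nbr u v u uv; have [y [yuvx uy vy]] := nbr u v x uv.
apply/existsP; exists x; apply/existsP; exists y; rewrite ux vx uy vy /= andbT.
by apply: contraNneq yuvx => ->; rewrite !inE eqxx orbT.
Qed.

(** A union bound over the triples [(u, v, w)]. *)
Lemma Gnp_rvd_maximal_ge :
  1 - n%:R ^+ 3 * (1 - p ^+ 2) ^+ (n - 3) <=
    Gnp_prob p (fun G : sgraph 'I_n => connected_graph G && (rvd G == n)).
Proof.
set A := (X in Gnp_prob p X); rewrite lerBlDl -lerBlDr -Gnp_probC Gnp_probE.
have /andP[p0 p1] := p01.
pose P (t : 'I_n * 'I_n * 'I_n) := t.1.1 != t.1.2.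
apply: (@le_trans _ _ ('E (fun E => \sum_(t | P t)
    (no_common_nbr t.1.1 t.1.2 t.2 E)%:R))).
  apply: le_E => E; case: (boolP (A _)) => AE /=; first exact: sumr_ge0.
  have [t Pt tE] : exists2 t, P t & no_common_nbr t.1.1 t.1.2 t.2 E.
    apply/exists_inP; apply: contraNT AE; rewrite negb_exists => /forallP H.
    apply: rvd_maximal_of_common_nbrs => u v w uv.
    by have := H (u, v, w); rewrite negb_and /P /= uv.
  by rewrite (bigD1 t)//= tE lerDl sumr_ge0.
rewrite mean_sum.
apply: (@le_trans _ _ (\sum_(t | P t) (1 - p ^+ 2) ^+ (n - 3))).
  apply: ler_sum => t Pt; rewrite mean_no_common_nbr//.
  apply: ler_wiXn2l; first by rewrite subr_ge0 expr_le1.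
    by rewrite gerBl sqr_ge0.
  rewrite cardsCs finset.setCK card_ord leq_sub2l//.
  rewrite finset.setUC cardsU1 cards2.
  by case: (_ \notin _); case: (_ != _).
rewrite sumr_const -[leLHS]mulr_natl -natrX ler_wpM2r//.
  by rewrite exprn_ge0// subr_ge0 expr_le1.
by rewrite ler_nat (leq_trans (max_card _))// !card_prod card_ord expnS -mulnn mulnA.
Qed.

(** The neighbourhood of [u] in [graph_of E]. *)
Definition nbrs u E : {set 'I_n} := [set x | (x != u) && ([set u; x]%SET \in E)]%SET.

(** For a fixed set [A] the neighbourhood of [v] meets [A] with probability
    [1 - (1 - p) ^ #|A|]. *)
Lemma mean_meets (A : {set 'I_n}) v : v \notin A ->
  'E (fun E => 1 - \prod_(a in A) (1 - ([set v; a]%SET \in E)%:R)) = 1 - (1 - p) ^+ #|A|.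
Proof.
move=> vA; rewrite meanB1; congr (1 - _).
rewrite (mean_indep_prod _ (B := fun a => [set [set v; a]%SET]%SET)).
- rewrite -prodr_const; apply: eq_bigr => a aA.
  by rewrite meanB1 mean_edge//; apply: contraNneq vA => ->.
- by move=> a aA; apply: depends_on1B; apply: depends_on_mem; rewrite inE.
- move=> a b aA bA ab; rewrite disjoints1 inE.
  have va : v != a by apply: contraNneq vA => ->.
  have vb : v != b by apply: contraNneq vA => ->.
  by apply: contraNneq ab => /(edge_inj vb)[_ ->].
Qed.

(** Given that [A] is the neighbourhood of [u], the events that [v] has a
    neighbour in [A], for [v] outside [A] and [u], are independent. *)
Lemma mean_nbrs u (A : {set 'I_n}) : u \notin A ->
  'E (fun E => (nbrs u E == A)%:R *
     \prod_(v in ~: (u |: A)%SET) (1 - \prod_(a in A) (1 - ([set v; a]%SET \in E)%:R)))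
  = 'E (fun E => (nbrs u E == A)%:R) * (1 - (1 - p) ^+ #|A|) ^+ (n.-1 - #|A|).
Proof.
move=> uA; pose B := [set e : {set 'I_n} | u \in e]%SET.
rewrite (@mean_indep _ _ _ B).
- congr (_ * _); rewrite (mean_indep_prod _
      (B := fun v => [set [set v; a]%SET | a in A]%SET)).
  + have -> : (n.-1 - #|A| = #|~: (u |: A)%SET|)%N.
      by rewrite [RHS]cardsCs finset.setCK card_ord cardsU1 uA -subn1 -subnDA.
    rewrite -prodr_const; apply: eq_bigr => v.
    by rewrite !inE negb_or => /andP[_ vA]; exact: mean_meets.
  + move=> v _; apply/depends_on1B/depends_on_prod => a aA.
    by apply/depends_on1B/depends_on_mem; apply: imset_f.
  + move=> v w; rewrite !inE !negb_or => /andP[vu vA] /andP[wu wA] vw.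
    rewrite -finset.setI_eq0; apply/eqP/setP => e; rewrite !inE; apply/negP.
    move=> /andP[/imsetP[a aA ->] /imsetP[b bA]] /edge_inj vawb.
    have vb : v != b by apply: contraNneq vA => ->.
    by have [vw' _] := vawb vb; rewrite vw' eqxx in vw.
- move=> E E' /setP EE'; congr (_ == _)%:R; apply/setP => x; rewrite !inE.
  by have := EE' [set u; x]%SET; rewrite !inE eqxx !andbT => ->.
- apply: depends_on_prod => v; rewrite !inE negb_or => /andP[vu vA].
  apply/depends_on1B/depends_on_prod => a aA; apply/depends_on1B/depends_on_mem.
  rewrite !inE negb_or eq_sym vu /=.
  by apply: contraNneq uA => ->.
Qed.

(** Exponential Markov inequality for the degree of [u], at the exponent [1 / 2]:
    as [expR (1 / 2) <= 2], each possible edge contributes a factor of at most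
    [1 + p <= expR p]. *)
Lemma degree_tail u (t : R) :
  'E (fun E => (t <= #|nbrs u E|%:R :> R)%:R) <= expR (n%:R * p - t / 2).
Proof.
have /andP[p0 p1] := p01; pose a : R := expR 2^-1.
have a1 : 1 <= a by rewrite -expR0 ler_expR; lra.
have a2 : a <= 2 := expR_half_le2 R.
apply: (@le_trans _ _ ('E (fun E => expR (- (t / 2)) *
    \prod_(x | x != u) (1 + (a - 1) * ([set u; x]%SET \in E)%:R)))).
  apply: le_E => E; have -> : \prod_(x | x != u) (1 + (a - 1) *
      ([set u; x]%SET \in E)%:R) = expR (#|nbrs u E|%:R / 2).
    rewrite mulrC expRM_natr -/a -prodr_const big_mkcond [RHS]big_mkcond.
    apply: eq_bigr => x _; rewrite !inE; case: (x != u) => //=.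
    by case: (_ \in E); rewrite ?mulr1 ?mulr0 ?addr0// addrC subrK.
  rewrite -expRD; case: (leP t) => /= tE; last exact: expR_ge0.
  by rewrite mulr1n -[leLHS]expR0 ler_expR; lra.
rewrite meanZ (mean_indep_prod _ (B := fun x => [set [set u; x]%SET]%SET)).
- rewrite [n%:R * p - _]addrC expRD ler_wpM2l ?expR_ge0//.
  have -> : \prod_(x | x != u) 'E (fun E => 1 + (a - 1) * ([set u; x]%SET \in E)%:R)
      = (1 + (a - 1) * p) ^+ n.-1.
    have -> : n.-1 = #|[pred x | x != u]| by rewrite cardC1 card_ord.
    rewrite -prodr_const; apply: eq_bigr => x xu.
    by rewrite meanD mean1 meanZ mean_edge// eq_sym.
  rewrite [n%:R * p]mulrC expRM_natr; apply: (@le_trans _ _ ((1 + (a - 1) * p) ^+ n)).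
    by apply: ler_weXn2l; [nra|lia].
  rewrite lerXn2r ?nnegrE ?expR_ge0//; first nra.
  by apply: le_trans (expR_ge1Dx p); nra.
- by move=> x xu E E' /(depends_on_mem (set11 _)); rewrite /= => ->.
- move=> x y; rewrite ![_ == u]eq_sym => ux uy xy; rewrite disjoints1 inE.
  by apply: contraNneq xy => /(edge_inj uy)[_ ->].
Qed.

(** Either the degree of the fixed vertex [u] is at least [t], or all other
    vertices outside the neighbourhood of [u] have a neighbour in it; [b] bounds
    the probability of the latter for each possible degree [k] of [u]. *)
Lemma Gnp_rvd_maximal_le (u : 'I_n) (t b : R) : 0 <= b ->
    (forall k, k%:R < t -> (1 - (1 - p) ^+ k) ^+ (n.-1 - k) <= b) ->
  Gnp_prob p (fun G : sgraph 'I_n => connected_graph G && (rvd G == n))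
    <= expR (n%:R * p - t / 2) + b.
Proof.
move=> b0 bP; rewrite Gnp_probE.
pose small (A : {set 'I_n}) := (u \notin A) && (#|A|%:R < t).
pose F (A : {set 'I_n}) E : R := (nbrs u E == A)%:R *
  \prod_(v in ~: (u |: A)%SET) (1 - \prod_(a in A) (1 - ([set v; a]%SET \in E)%:R)).
have F0 A E : 0 <= F A E.
  apply: mulr_ge0 => //; apply: prodr_ge0 => v _; rewrite subr_ge0.
  apply: prodr_ile1 => a _; case: (_ \in E); rewrite ?subrr ?subr0 ?ler01 ?lexx//.
apply: (@le_trans _ _ ('E (fun E => (t <= #|nbrs u E|%:R :> R)%:R +
    \sum_(A | small A) F A E))).
  apply: le_E => E; case: (leP t) => [_|Et] /=.
    by case: (_ && _); rewrite ?lerDl ?addr_ge0 ?sumr_ge0.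
  rewrite add0r; case: (boolP (_ && _)) => [/andP[_ /eqP rvdE]|_]; last exact: sumr_ge0.
  rewrite (bigD1 (nbrs u E)) /=; last by rewrite /small Et !inE eqxx.
  suff -> : F (nbrs u E) E = 1 by rewrite lerDl sumr_ge0.
  rewrite /F eqxx mul1r big1// => v; rewrite !inE !negb_or => /andP[vu vE].
  have /existsP[x /existsP[y /and5P[_ ux vx _ _]]] : two_common_nbrs (graph_of E) u v.
    rewrite eq_sym in vu; apply: contraT => nG.
    by have := rvd_lt_card vu nG; rewrite rvdE card_ord ltnn.
  move: ux vx; rewrite !adj_graph_of => /andP[ux uxE] /andP[_ vxE].
  rewrite (bigD1 x) /=; last by rewrite inE eq_sym ux.
  by rewrite vxE subrr mul0r subr0.
rewrite meanD lerD ?degree_tail// mean_sum.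
apply: (@le_trans _ _ (\sum_(A | small A) 'E (fun E => (nbrs u E == A)%:R) * b)).
  apply: ler_sum => A /andP[uA At]; rewrite /F mean_nbrs//.
  apply: ler_wpM2l; last exact: bP.
  by apply: sumr_ge0 => E _; rewrite mulr_ge0 ?subset_weight_ge0//; exact: edge_prob01.
rewrite -mulr_suml -[leRHS]mul1r ler_wpM2r// -mean_sum.
rewrite -[leRHS](mean1 edge_prob); apply: le_E => E.
have [sE|sE] := boolP (small (nbrs u E)).
  rewrite (bigD1 (nbrs u E)) //= eqxx big1 ?addr0// => A /andP[_].
  by rewrite eq_sym => /negPf->.
rewrite big1// => A sA; case: eqVneq => // EA.
by rewrite EA sA in sE.
Qed.

End RandomGraph.

(** * Asymptotic estimates *)

Section Asymptotics.
Context {R : realType}.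
Implicit Types p : R.
Local Open Scope classical_set_scope.

Lemma Gnp_prob_le1 n p (A : pred (sgraph 'I_n)) : 0 <= p <= 1 -> Gnp_prob p A <= 1.
Proof.
move=> p01; rewrite Gnp_probE -[leRHS](mean1 (@edge_prob R n p)).
by apply: le_mean => [e|E]; [exact: edge_prob01|case: (A _)].
Qed.

Lemma almost_surely_ge (p : nat -> R) (A : forall n, pred (sgraph 'I_n)) (K : R) :
    (forall n, 0 <= p n <= 1) -> 0 < K ->
    (\forall n \near \oo, 1 - K / n%:R <= Gnp_prob (p n) (A n)) ->
  almost_surely p A.
Proof.
move=> p01 K0 AK; apply/cvgrPdist_le => e e0; near=> n.
rewrite ger0_norm ?subr_ge0 ?Gnp_prob_le1//.
have n0 : (0 : R) < n%:R by rewrite ltr0n; near: n; exact: nbhs_infty_gt.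
apply: (@le_trans _ _ (K / n%:R)).
  by rewrite lerBlDl -lerBlDr; near: n.
rewrite ler_pdivrMr// mulrC -ler_pdivrMr//.
by near: n; exact: nbhs_infty_ger.
Unshelve. all: by end_near. Qed.

Local Notation f n := (Num.sqrt (ln (n%:R : R) / n%:R)).

Lemma sqr_threshold n : (0 < n)%N -> f n ^+ 2 = ln (n%:R : R) / n%:R.
Proof. by move=> n0; rewrite sqr_sqrtr// divr_ge0// ln_ge0// ler1n. Qed.

Lemma expr1B_le (x : R) m : x <= 1 -> (1 - x) ^+ m <= expR (- (x * m%:R)).
Proof.
move=> x1; rewrite -mulNr expRM_natr lerXn2r ?nnegrE ?expR_ge0 ?subr_ge0//.
exact: expR_ge1Dx.
Qed.

Lemma triple_failure_le n p : (6 <= n)%N -> 0 <= p <= 1 -> 3 * f n <= p ->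
  n%:R ^+ 3 * (1 - p ^+ 2) ^+ (n - 3) <= 1 / n%:R.
Proof.
move=> n6 /andP[p0 p1] fp; have n0 : (0 : R) < n%:R by rewrite ltr0n; lia.
have n6R : (6 : R) <= n%:R by rewrite (ler_nat R 6).
have ln0 : 0 <= ln (n%:R : R) by rewrite ln_ge0// ler1n; lia.
have p2 : 9 * (ln (n%:R : R) / n%:R) <= p ^+ 2.
  rewrite -sqr_threshold; last by lia.
  have := sqrtr_ge0 (ln (n%:R : R) / n%:R); nra.
(* [9 * (n - 3) / n >= 4], with room to spare, since [n >= 6] *)
have pn : 4 * ln n%:R <= p ^+ 2 * (n - 3)%:R.
  rewrite natrB; last by lia.
  apply: (@le_trans _ _ (9 * (ln n%:R / n%:R) * (n%:R - 3))); last first.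
    by apply: ler_wpM2r => //; lra.
  have -> : 9 * (ln n%:R / n%:R) * (n%:R - 3) = ln (n%:R : R) * (9 * (n%:R - 3) / n%:R).
    by field; lra.
  rewrite mulrC ler_wpM2l// ler_pdivlMr//; lra.
apply: (@le_trans _ _ (n%:R ^+ 3 * expR (- ln n%:R * 4))).
  rewrite ler_wpM2l ?exprn_ge0//.
  apply: (le_trans (expr1B_le _ _)); first by rewrite expr_le1.
  by rewrite ler_expR; lra.
rewrite expRM_natr expRN lnK ?posrE// le_eqVlt; apply/orP; left.
by apply/eqP; field; lra.
Qed.

Lemma expRN_le (x : R) : 0 < x -> expR (- x) <= 2 / x ^+ 2.
Proof.
move=> x0; rewrite expRN -[leRHS]invrK lef_pV2 ?posrE ?invr_gt0 ?expR_gt0//.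
  apply: le_trans (expR_ge1Dxn 1 (ltW x0)); rewrite invf_div.
  by rewrite !factS fact0 muln1 lerDr.
by rewrite divr_gt0// exprn_gt0.
Qed.

Lemma expr1B_ge (p : R) k : 0 <= p <= 1 / 2 -> expR (- (2 * p * k%:R)) <= (1 - p) ^+ k.
Proof.
move=> /andP[p0 p1]; rewrite -mulNr expRM_natr lerXn2r ?nnegrE ?expR_ge0//; first lra.
rewrite expRN -[leRHS]invrK lef_pV2 ?posrE ?invr_gt0 ?expR_gt0//; last lra.
(* [1 <= (1 - p) * (1 + 2 * p)] *)
apply: le_trans (expR_ge1Dx _); rewrite -[leLHS]mul1r ler_pdivrMr; nra.
Qed.

Lemma threshold_le1 n : f n <= 1.
Proof.
rewrite -[leRHS]sqrtr1 ler_wsqrtr//; case: n => [|n]; first by rewrite invr0 mulr0.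
by rewrite ler_pdivrMr ?ltr0n// mul1r ltW// ln_sublinear ?ltr0n.
Qed.

Lemma Gnp_rvd_maximal_small n : (2 ^ 10 <= n)%N ->
  Gnp_prob (4^-1 * f n) (fun G : sgraph 'I_n => connected_graph G && (rvd G == n))
    <= 64 / n%:R.
Proof.
move=> n10; set s : R := Num.sqrt n%:R; set L := ln (n%:R : R).
have n10R : (2 ^+ 10 : R) <= n%:R by rewrite -natrX ler_nat.
have n0 : (0 : R) < n%:R by apply: lt_le_trans n10R; exact: exprn_gt0.
have s2 : s ^+ 2 = n%:R by rewrite sqr_sqrtr// ltW.
have s32 : 32 <= s.
  have s0 : 0 <= s := sqrtr_ge0 _.
  rewrite -(@ler_pXn2r _ 2) ?nnegrE// s2; apply: le_trans n10R; lra.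
have s0 : 0 < s by lra.
have Ls : L = 2 * ln s by rewrite /L -s2 lnXn// mulr_natl.
have L1 : 1 <= L.
  rewrite -[leLHS]expRK ler_ln ?posrE ?expR_gt0//.
  (* [exp 1 = exp (1 / 2) ^ 2 <= 4 <= n] *)
  apply: le_trans n10R; rewrite (_ : 1 = 2^-1 * 2%:R); last by field.
  rewrite expRM_natr.
  by have := expR_half_le2 R; have := expR_ge0 (2^-1 : R); nra.
have Lle : L <= 2 * s by rewrite Ls; have := ln_sublinear s0; lra.
have n1 : (0 < n)%N by lia.
have f2 := sqr_threshold n1; set fn : R := f n in f2 *; rewrite -/L in f2.
have f0 : 0 <= fn := sqrtr_ge0 _.
have nf2 : n%:R * fn ^+ 2 = L by rewrite f2; field; lra.
(* [fn = sqrt L / s] lies between [1 / s] and [1 / 4]: the lower bound makes the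
   degree tail small, the upper one leaves [n / 2] vertices outside [A]. *)
have sf : s * fn = Num.sqrt L.
  rewrite /s /fn -sqrtrM ?(ltW n0)//; congr Num.sqrt; rewrite -/L; field; lra.
have sf1 : 1 <= s * fn by rewrite sf -[leLHS]sqrtr1 ler_sqrt//; lra.
have f4 : fn <= 1 / 4.
  rewrite -(@ler_pXn2r _ 2) ?nnegrE ?divr_ge0//.
  have ss : 0 <= s * (s - 32) by rewrite mulr_ge0 ?subr_ge0// ltW.
  rewrite f2 ler_pdivrMr// -s2; lra.
set p := 4^-1 * fn.
have p01 : 0 <= p <= 1 by rewrite /p; apply/andP; split; lra.
apply: (le_trans (@Gnp_rvd_maximal_le R n p p01 (Ordinal n1) (4 * n%:R * p)
  (expR (- (s / 2))) (expR_ge0 _) _)).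
  move=> k kt; have k4 : k%:R <= n%:R / 4 :> R.
    by apply: (le_trans (ltW kt)); rewrite /p; nra.
  (* [2 * p * k <= 8 * n * p ^ 2 = L / 2 = ln s] *)
  have knx : expR (- ln s) <= (1 - p) ^+ k.
    apply: le_trans (expr1B_ge _ _); last by rewrite /p; apply/andP; split; lra.
    rewrite ler_expR lerN2.
    apply: (@le_trans _ _ (2 * p * (4 * n%:R * p))).
      apply: ler_wpM2l; last exact: ltW.
      by apply: mulr_ge0 => //; case/andP: p01.
    by rewrite /p; lra.
  have n1k : n%:R / 2 <= (n.-1 - k)%:R :> R.
    rewrite -subn1 -subnDA natrB ?natrD; first lra.
    by rewrite -(ler_nat R) natrD; lra.
  apply: (le_trans (expr1B_le _ _)).
    by rewrite exprn_ile1//; lra.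
  rewrite ler_expR lerN2.
  apply: (@le_trans _ _ (expR (- ln s) * (n%:R / 2))).
    by rewrite expRN lnK ?posrE// -s2 le_eqVlt; apply/orP; left; apply/eqP; field; lra.
  by apply: ler_pM.
have -> : n%:R * p - 4 * n%:R * p / 2 = - (n%:R * p) by field.
have e1 : expR (- (n%:R * p)) <= 32 / n%:R.
  apply: (@le_trans _ _ (expR (- (s / 4)))).
    by rewrite ler_expR lerN2 -s2 /p; nra.
  apply: (le_trans (expRN_le _)); first lra.
  rewrite -s2 le_eqVlt; apply/orP; left; apply/eqP; field; lra.
have e2 : expR (- (s / 2)) <= 8 / n%:R.
  apply: (le_trans (expRN_le _)); first lra.
  rewrite -s2 le_eqVlt; apply/orP; left; apply/eqP; field; lra.
apply: (le_trans (lerD e1 e2)); rewrite -mulrDl ler_wpM2r ?invr_ge0 ?ltW//; lra.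
Qed.

End Asymptotics.

Theorem theorem5p2 (R : realType) :
  sharp_threshold
    (fun n : nat => Num.sqrt (ln (n%:R : R) / n%:R))
    (fun n (G : sgraph 'I_n) => connected_graph G && (rvd G == n)).
Proof.
exists 4^-1, 3; split => //.
- apply: (@almost_surely_ge _ _ _ 64) => // [n|].
    have := @threshold_le1 R n; have := sqrtr_ge0 (ln (n%:R : R) / n%:R).
    by move=> f0 f1; apply/andP; split; lra.
  near=> n; rewrite Gnp_probC lerD2l lerN2; apply: Gnp_rvd_maximal_small.
  by near: n; exact: nbhs_infty_ge.
- move=> p p01 fp; apply: (@almost_surely_ge _ _ _ 1) => //; near=> n.
  apply: le_trans (Gnp_rvd_maximal_ge (p01 n)); rewrite lerD2l lerN2.
  apply: triple_failure_le => //; last by near: n.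
  by near: n; exact: nbhs_infty_ge.
Unshelve. all: by end_near. Qed.
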